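(* Let $X$ and $Y$ be non-negative continuous random variables and let $\eta>0$. If $X\leq_{disp}Y$, then $X\leq_{DQFGCPE}Y$.
   Context: Random variables are non-negative and absolutely continuous. For a random variable $X$ with distribution function $G$ and density $g$, the quantile function is $Q_X(v)=\inf\{x: G(x)\ge v\}$, $0\le v\le 1$, and the quantile density function is $q_X(v)=\frac{d}{dv}Q_X(v)$; it satisfies $q_X(v)\,g(Q_X(v))=1$. For $\eta>0$ the dynamic quantile-based fractional generalized cumulative past entropy (DQFGCPE) of $X$ is $$\mathcal{C}\mathcal{P}\xi_Q^\eta(X,v)=\frac{1}{v\,\Gamma(\eta+1)}\int_0^v p\,[\ln v-\ln p]^\eta q_X(p)\,dp,\qquad v\in(0,1)$$ (integral assumed finite). Orders: $X\leq_{disp}Y$ (dispersive order) means that $Q_Y(v)-Q_X(v)$ is increasing (non-decreasing) in $v\in(0,1)$; $X\leq_{DQFGCPE}Y$ means $\mathcal{C}\mathcal{P}\xi_Q^\eta(X,v)\le\mathcal{C}\mathcal{P}\xi_Q^\eta(Y,v)$ for all $v\in(0,1)$. *)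

(* Defs.v *)
From HB Require Import structures.
From mathcomp Require Import all_boot all_order all_algebra.
From mathcomp Require Import all_classical all_reals all_analysis.

Set Implicit Arguments.
Unset Strict Implicit.
Unset Printing Implicit Defensive.

Import Order.TTheory GRing.Theory Num.Theory.
Import numFieldNormedType.Exports.

Local Open Scope classical_set_scope.
Local Open Scope ring_scope.

Definition Gamma (R : realType) (s : R) : R :=
  \int[lebesgue_measure]_(t in `]0, +oo[) (t `^ (s - 1) * expR (- t)).

Section Quantile.
Context d (T : measurableType d) (R : realType) (P : probability T R).
Implicit Types (X : {RV P >-> R}) (eta v p : R).

Definition nonneg_rv X : Prop := {ae P, forall t, 0 <= X t}.

Definition abs_continuous_rv X : Prop :=
  distribution P X `<< (@lebesgue_measure R).

(* For v in ]0, 1[ the set below is nonempty and bounded from below; for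
   v <= 0 or v >= 1 the value of [inf] may be the default 0, but no such v
   is used. *)
Definition quantile X v : R := inf [set x : R | (v%:E <= cdf X x)%E].

(* [quantile X] is monotone on ]0, 1[; where it is not derivable, [derive1] takes
   a meaningless value. For an absolutely continuous law with density g,
   derive1 (quantile X) v * g (quantile X v) = 1 for almost every v in ]0, 1[,
   so such points do not affect integrals. *)
Definition quantile_density X : R -> R := derive1 (quantile X).

Definition dqfgcpe_integrand eta X v p : R :=
  p * (ln v - ln p) `^ eta * quantile_density X p.

Definition dqfgcpe_finite eta X : Prop :=
  forall v, v \in `]0, 1[ ->
    (@lebesgue_measure R).-integrable `]0, v[
      (EFin \o dqfgcpe_integrand eta X v).

Definition dqfgcpe eta X v : R :=
  (v * Gamma (eta + 1))^-1 *
  \int[lebesgue_measure]_(p in `]0, v[) dqfgcpe_integrand eta X v p.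

End Quantile.

Section Orders.
Context d1 (T1 : measurableType d1) d2 (T2 : measurableType d2).
Context (R : realType) (P1 : probability T1 R) (P2 : probability T2 R).
Implicit Types (X : {RV P1 >-> R}) (Y : {RV P2 >-> R}) (eta : R).

Definition disp_le X Y : Prop :=
  {in `]0, 1[ &, {homo (fun v : R => quantile Y v - quantile X v) :
    u v / u <= v}}.

Definition dqfgcpe_le eta X Y : Prop :=
  forall v : R, v \in `]0, 1[ -> dqfgcpe eta X v <= dqfgcpe eta Y v.

End Orders.

(* Main.v *)
Require Import Defs.
From HB Require Import structures.
From mathcomp Require Import all_boot all_order all_algebra.
From mathcomp Require Import all_classical all_reals all_analysis.
From mathcomp Require Import measurable_realfun.

Import Order.TTheory GRing.Theory Num.Theory.
Import numFieldNormedType.Exports.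

Local Open Scope classical_set_scope.
Local Open Scope ring_scope.

(** The index of X at v is a nonnegative constant times the integral over
    ]0, v[ of p (ln v - ln p)^eta q_X(p), whose weight p (ln v - ln p)^eta is
    nonnegative and does not depend on the variable.  It therefore suffices
    that q_X <= q_Y almost everywhere on ]0, 1[.  Where both quantile functions
    are derivable this is immediate: Q_Y - Q_X is nondecreasing, so its
    derivative q_Y - q_X is nonnegative ([quantile_density_le]).

    What has to be proved is that a quantile function is derivable almost
    everywhere ([ae_derivable_quantile]); elsewhere its density takes a
    conventional value, about which the dispersive order says nothing.  Instead
    of Lebesgue's theorem on monotone functions, the proof uses the absolute
    continuity of the law.  By Radon-Nikodym and the Lebesgue differentiation
    theorem, the distribution function F is derivable, with derivative equal to
    the density g, outside a Lebesgue-null set, hence outside a null set of the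
    law; and g is positive almost surely ([ae_derivable_cdf]).  The image of
    Lebesgue measure on ]0, 1[ by the quantile function Q is the law of X
    ([lebesgue_measure_quantile_preimage]), so for almost every v the derivative
    F'(Q v) exists and is positive.  At such a v, the inverse Q is derivable
    ([derivable_galois_inverse]), although F need not be injective near Q v. *)

(** * Derivative of a generalized inverse *)

(** The usual rule (F^-1)' = 1 / F' for an inverse on one side only: F o Q is
    the identity but F may have plateaus accumulating at Q v, so Q o F need not
    be the identity near Q v.  The difference quotient of Q at v is still the
    inverse of that of F taken at the increment k(h) = Q(v + h) - Q v.  This
    increment is nonzero for h <> 0, as F o Q = id, and it tends to 0 because a
    positive F'(Q v) prevents F from having a plateau that starts at Q v. *)
Lemma derivable_galois_inverse (R : realType) (F Q : R -> R) (v : R) :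
  {homo F : x y / x <= y} ->
  {in `]0, 1[, forall w x, (Q w <= x) = (w <= F x)} ->
  {in `]0, 1[, cancel Q F} ->
  v \in `]0, 1[ -> derivable F (Q v) 1 -> 0 < derive1 F (Q v) ->
  derivable Q v 1.
Proof.
move=> F_nd galois FQ v01 dF F'_gt0.
have [v_gt0 v_lt1] : 0 < v /\ v < 1 by move: v01; rewrite in_itv/= => /andP.
pose u k := k^-1 * (F (k + Q v) - F (Q v)).
have u_cvg : u k @[k --> 0^'] --> derive1 F (Q v).
  have -> : u = fun k => k^-1 *: ((F \o shift (Q v)) (k *: 1) - F (Q v)).
    by apply/funext => k; rewrite /u /= [k *: 1]mulr1.
  by rewrite derive1E; exact: dF.
have F_left e : 0 < e -> F (Q v - e) < v.
  by move=> e0; rewrite ltNge -galois// -ltNge gtrBl.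
have F_right e : 0 < e -> v < F (Q v + e).
  (* Otherwise F is constant on [Q v, Q v + e], and F'(Q v) = 0. *)
  move=> e0; rewrite ltNge; apply/negP => Fe_le.
  have u0 : u k @[k --> 0^'+] --> 0.
    apply: cvg_near_cst; near=> k.
    have k0 : 0 < k by near: k; exact: nbhs_right_gt.
    have ke : k < e by near: k; exact: nbhs_right_lt.
    suff Fk : F (k + Q v) = F (Q v) by rewrite /u Fk subrr mulr0.
    apply/le_anti/andP; split; last by rewrite F_nd// lerDr ltW.
    by rewrite [leRHS]FQ// (le_trans _ Fe_le)// F_nd// addrC lerD2l ltW.
  have := cvg_unique _ (cvg_dnbhs_at_right u_cvg) u0.
  by move=> F'0; rewrite F'0// ltxx in F'_gt0.
pose k h := Q (h + v) - Q v.
have near_itv a b : a < v -> v < b -> \forall h \near 0^', h + v \in `]a, b[.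
  move=> av vb; apply: nbhs_dnbhs; near=> h.
  have : h \in `]a - v, b - v[.
    by near: h; apply: near_in_itvoo; rewrite in_itv/= subr_lt0 subr_gt0 av.
  by rewrite !in_itv/= ltrBlDr ltrBrDr.
have k_cvg : k h @[h --> 0^'] --> 0^'.
  move=> A [e /= e0 eA].
  suff : \forall h \near 0^', A (k h) by [].
  have e20 : 0 < e / 2 by rewrite divr_gt0.
  near=> h; apply: eA => /=.
    rewrite sub0r normrN /k.
    have h01 : h + v \in `]0, 1[ by near: h; exact: near_itv.
    have : h + v \in `]F (Q v - e / 2), F (Q v + e / 2)[.
      by near: h; apply: near_itv; [exact: F_left|exact: F_right].
    rewrite in_itv/= => /andP[Fh hF].
    rewrite (@le_lt_trans _ _ (e / 2))//; last first.
      by rewrite gtr_pMr// invf_lt1// ltr1n.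
    rewrite ler_norml lerBlDl galois// (ltW hF) andbT lerBrDl ltW//.
    by rewrite ltNge galois// -ltNge.
  have h0 : h != 0 by near: h; exact: nbhs_dnbhs_neq.
  apply: contra_neq h0 => /subr0_eq Qh.
  have h01 : h + v \in `]0, 1[ by near: h; exact: near_itv.
  by apply: (addIr v); rewrite add0r -[LHS]FQ// Qh FQ.
have uk_cvg : (u (k h))^-1 @[h --> 0^'] --> (derive1 F (Q v))^-1.
  apply: cvgV; first exact: lt0r_neq0.
  exact: cvg_comp k_cvg u_cvg.
rewrite /derivable; apply/cvg_ex; exists (derive1 F (Q v))^-1.
apply: cvg_trans uk_cvg; apply: near_eq_cvg; near=> h.
have h01 : h + v \in `]0, 1[ by near: h; exact: near_itv.
by rewrite /u /k /= subrK !FQ// addrK invfM invrK [h *: 1]mulr1 mulrC.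
Unshelve. all: by end_near. Qed.

(** * Quantile functions and their almost everywhere derivability *)

Section quantile.
Context d (T : measurableType d) (R : realType) (P : probability T R).
Variable X : {RV P >-> R}.

Local Notation law := (distribution P X).
Local Notation mu := (@lebesgue_measure R).

Lemma cdf_fineE x : cdf X x = (fine (cdf X x))%:E.
Proof. by rewrite fineK// fin_num_measure. Qed.

(** Right continuity of the distribution function F makes the infimum that
    defines the quantile function Q a minimum; this gives the Galois connection
    between Q and F through which everything below is derived. *)
Lemma quantile_le_cdf : {in `]0, 1[, forall v x,
  (quantile X v <= x) = (v%:E <= cdf X x)%E}.
Proof.
move=> v; rewrite in_itv/= => /andP[v_gt0 v_lt1] x.
pose A := [set x : R | (v%:E <= cdf X x)%E].
have A_upper y z : y <= z -> A y -> A z.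
  by move=> yz /le_trans; apply; exact: cdf_nondecreasing.
have A_inf : has_inf A.
  split.
    apply: contrapT => /nonemptyPn A0.
    suff : (1 <= v%:E)%E by rewrite lee_fin leNgt v_lt1.
    apply: (cvge_le _ (cvg_cdfy1 X)); apply: nearW => y.
    rewrite leNgt; apply/negP => /ltW vy.
    by have : A y by []; rewrite A0.
  apply: contrapT => /has_lbPn Alb.
  suff : (v%:E <= 0)%E by rewrite lee_fin leNgt v_gt0.
  apply: (cvge_ge _ (cvg_cdfNy0 X)); apply: nearW => y.
  by have [z Az /ltW zy] := Alb y; exact: A_upper zy Az.
have A_infA : A (inf A).
  apply: (@cvge_ge _ (inf A)^'+ _ _ (cdf X) (cdf X (inf A))); last first.
    exact: cdf_right_continuous.
  near=> y.
  have infAy : inf A < y by near: y; exact: nbhs_right_gt.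
  have [z Az /ltW zy] := inf_lt A_inf.1 infAy.
  exact: A_upper zy Az.
apply/idP/idP => [Qx|vx]; first exact: A_upper Qx A_infA.
exact: (ge_inf A_inf.2).
Unshelve. all: by end_near. Qed.

Lemma quantile_nondecreasing :
  {in `]0, 1[ &, {homo quantile X : u v / u <= v}}.
Proof.
move=> u v u01 v01 uv; rewrite quantile_le_cdf//.
by rewrite (@le_trans _ _ v%:E) ?lee_fin// -quantile_le_cdf.
Qed.

Lemma measurable_quantile : measurable_fun (`]0, 1[ : set R) (quantile X).
Proof.
apply: (measurability (@RGenOInfty.G R)).
  exact: RGenOInfty.measurableE.
move=> _ [_ [x ->] <-].
apply: is_interval_measurable => u v/=.
rewrite !in_itv/= !andbT => -[/andP[u0 u1] xu] [/andP[v0 v1] xv] w /andP[uw wv].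
have w01 : 0 < w < 1 by rewrite (lt_le_trans u0)//= (le_lt_trans wv).
split=> //; rewrite /preimage/= in_itv/= andbT (lt_le_trans xu)//.
by apply: quantile_nondecreasing; rewrite ?in_itv/= ?u0.
Qed.

(** Inverse transform sampling: Q maps the uniform law on ]0, 1[ to the law of
    X.  Both measures give ]x, +oo[ the mass 1 - F x, by the Galois connection, and
    these rays form a pi-system that generates the Borel sets. *)
Lemma lebesgue_measure_quantile_preimage (A : set R) : measurable A ->
  mu (`]0, 1[ `&` quantile X @^-1` A) = law A.
Proof.
move=> mA.
have mD : measurable (`]0, 1[ : set R) by [].
pose Q : R -> R := quantile X \_ `]0, 1[.
have mQ : measurable_fun setT (Q : measurableTypeR R -> R).
  by apply/(measurable_restrictT _ mD); exact: measurable_quantile.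
unshelve epose (m1 := pushforward (mrestr mu mD) (Q : measurableTypeR R -> R)
  : {measure set R -> \bar R}); first exact: mQ.
have m1E B : m1 B = mu (`]0, 1[ `&` quantile X @^-1` B).
  rewrite /m1 /= /pushforward/= /mrestr /= setIC; congr (mu _).
  by apply/seteqP; split=> w /= [w01]; rewrite /Q patchE mem_set.
rewrite -m1E.
apply: (@measure_unique _ R R (@RGenOInfty.G R)
  (fun k => `](- k%:R), +oo[%classic) _ _ _ _ m1 law) => //.
- exact: RGenOInfty.measurableE.
- move=> _ _ [x ->] [y ->]; exists (Num.max x y).
  by apply/seteqP; split=> w; rewrite /= !in_itv/= !andbT gt_max => /andP.
- by move=> k; exists (- k%:R).
- rewrite -subTset => x _; exists (Num.truncn (- x)).+1 => //=.
  by rewrite in_itv/= andbT ltrNl truncnS_gt.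
- move=> _ [x ->]; rewrite m1E.
  have cdf01 : 0 <= fine (cdf X x) <= 1.
    by rewrite -!lee_fin -cdf_fineE cdf_ge0 cdf_le1.
  transitivity (mu `]fine (cdf X x), 1[).
    congr (mu _); apply/seteqP; split=> w /=; rewrite !in_itv/= !andbT.
      move=> [w01]; rewrite ltNge quantile_le_cdf// -ltNge cdf_fineE lte_fin => ->.
      by case/andP: w01.
    move=> /andP[cw w1]; have w01 : 0 < w < 1.
      by rewrite w1 andbT (le_lt_trans _ cw)//; case/andP: cdf01.
    by split=> //; rewrite ltNge quantile_le_cdf// -ltNge cdf_fineE lte_fin.
  rewrite lebesgue_measure_itv/=.
  transitivity (ccdf X x); last by [].
  rewrite ccdf_1_cdf cdf_fineE -EFinB lte_fin; case: ltP => // c1.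
  have -> : fine (cdf X x) = 1.
    by apply/le_anti; rewrite c1 andbT; case/andP: cdf01.
  by rewrite subrr.
- move=> k; rewrite m1E (@le_lt_trans _ _ (mu `]0, 1[))//.
    by rewrite le_measure ?inE//; apply: measurable_quantile.
  by rewrite lebesgue_measure_itv/= lte_fin ltr01 oppr0 adde0 ltry.
Qed.

(** If w < F(Q w), then Q is constant on the nondegenerate interval
    ]w, F(Q w)[, and its value there is an atom of the law. *)
Lemma cdf_quantile : (forall x, law [set x] = 0%E) ->
  {in `]0, 1[, cancel (quantile X) (fine \o cdf X)}.
Proof.
move=> law1 w w01 /=; set c := fine _.
have w_le_c : w <= c by rewrite -lee_fin -cdf_fineE -quantile_le_cdf.
apply/eqP; rewrite eq_le w_le_c andbT leNgt; apply/negP => wc.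
have c1 : c <= 1 by rewrite -lee_fin -cdf_fineE cdf_le1.
have w0 : 0 < w by move: w01; rewrite in_itv/= => /andP[].
have : (mu `]w, c[ <= law [set quantile X w])%E.
  rewrite -lebesgue_measure_quantile_preimage//.
  rewrite le_measure ?inE//; first exact: measurable_quantile.
  move=> u; rewrite /= in_itv/= => /andP[wu uc].
  have u01 : u \in `]0, 1[.
    by rewrite in_itv/= (lt_trans w0)//= (lt_le_trans uc).
  split=> //; apply/le_anti/andP; split.
    by rewrite quantile_le_cdf// cdf_fineE lee_fin ltW.
  by rewrite quantile_nondecreasing// ltW.
rewrite law1 (lebesgue_measure_itv `]w, c[)/= lte_fin wc.
by rewrite -EFinB lee_fin subr_le0 leNgt wc.
Qed.

(** The exceptional set is the union of the Lebesgue-null set where F' = g fails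
    and of the zero set of g, whose mass is the integral of g over it. *)
Lemma ae_derivable_cdf : abs_continuous_rv X ->
  {ae law, forall x,
    derivable (fine \o cdf X) x 1 /\ 0 < derive1 (fine \o cdf X) x}.
Proof.
move=> X_ac.
(* [R] and [measurableTypeR R] have the same measurable sets but different
   displays, and Lebesgue measure lives on the latter. *)
have mX : measurable_fun setT (X : T -> measurableTypeR R) :=
  measurable_funPT X.
pose X' : {mfun T >-> measurableTypeR R} :=
  @mfun_Sub _ _ _ (measurableTypeR R) X (mem_set mX).
have [g [g_ge0 g_fin g_int lawE]] :=
  @radon_nikodym_sigma_finite _ (measurableTypeR R) R (@lebesgue_measure R)
    (distribution P X') X_ac.
have gE : EFin \o (fine \o g) = g by apply/funext => x /=; rewrite fineK.
have FE : (fun x => \int[mu]_(t in [set` `]-oo, x]]) (fine \o g) t) =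
    fine \o cdf X.
  apply/funext => x /=; rewrite [cdf X x]lawE// /Rintegral.
  by under eq_integral do rewrite /= fineK//.
have [N [mN N0 FTC_N]] : {ae mu, forall x, derivable (fine \o cdf X) x 1 /\
    derive1 (fine \o cdf X) x = fine (g x)}.
  rewrite -FE; apply: FTC1Ny => [y|].
    by rewrite gE; exact: integrableS g_int.
  by apply: open_integrable_locally; [exact: openT|rewrite gE].
pose Z := g @^-1` [set 0%E].
have mZ : measurable Z.
  rewrite -[Z]setTI; exact: (measurable_int _ g_int).
have Z0 : law Z = 0%E.
  rewrite [LHS]lawE//; apply: integral0_eq => x; exact.
have lawN : law N = 0%E.
  by move/null_content_dominatesP : X_ac; exact.
exists (N `|` Z); split.
- exact: measurableU.
- by rewrite measureU0.
- move=> x /=; apply: contra_notP => /not_orP[Nx Zx].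
  have [dF ->] := contrapT (contra_not (FTC_N x) Nx).
  split=> //; rewrite lt_neqAle fine_ge0// andbT.
  by apply/eqP => gx0; apply: Zx; rewrite /Z/= -[g x]fineK// -gx0.
Qed.

(** The exceptional set is the preimage by Q of that of F, a null set of the law,
    so it is Lebesgue-null. *)
Lemma ae_derivable_quantile : abs_continuous_rv X ->
  {ae mu, forall v, v \in `]0, 1[ -> derivable (quantile X) v 1}.
Proof.
move=> X_ac; have [N [mN N0 dF_N]] := ae_derivable_cdf X_ac.
exists (`]0, 1[ `&` quantile X @^-1` N); split.
- exact: measurable_quantile.
- by rewrite lebesgue_measure_quantile_preimage.
- move=> v /= /not_implyP[v01 ndQ]; split=> //.
  apply: contrapT => Nv; apply: ndQ.
  have [dF F'_gt0] := contrapT (contra_not (dF_N (quantile X v)) Nv).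
  apply: (derivable_galois_inverse _ (fine \o cdf X)) => //.
  - by move=> x y xy /=; rewrite -lee_fin -!cdf_fineE cdf_nondecreasing.
  - by move=> w w01 x; rewrite quantile_le_cdf// cdf_fineE lee_fin.
  - apply: cdf_quantile => x.
    move/null_content_dominatesP : X_ac; apply=> //.
    exact: lebesgue_measure_set1.
Qed.

End quantile.

(** * Comparison of the integrals *)

Lemma ae_le_Rintegral d (T : measurableType d) (R : realType)
    (mu : {measure set T -> \bar R}) (D : set T) (f g : T -> R) :
  measurable D ->
  mu.-integrable D (EFin \o f) -> mu.-integrable D (EFin \o g) ->
  {ae mu, forall x, D x -> f x <= g x} ->
  \int[mu]_(x in D) f x <= \int[mu]_(x in D) g x.
Proof.
move=> mD intf intg fg.
case: fg => N [mN N0 fgN]; rewrite /Rintegral.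
rewrite (negligible_integral mN _ intf)// (negligible_integral mN _ intg)//.
have mDN : measurable (D `\` N) by exact: measurableD.
apply: le_Rintegral => //.
- exact: integrableS intf.
- exact: integrableS intg.
- by move=> x [Dx Nx]; have := contrapT (contra_not (fgN x) Nx); apply.
Qed.

(** Comparison on the right of v is enough, since a derivative is also the
    limit of the right difference quotients. *)
Lemma derive1_ge0_at_right (R : realType) (f : R -> R) (v : R) :
  derivable f v 1 -> (\forall h \near 0^'+, f v <= f (h + v)) ->
  0 <= derive1 f v.
Proof.
move=> df f_nd.
have u_cvg : h^-1 * (f (h + v) - f v) @[h --> 0^'] --> derive1 f v.
  rewrite derive1E; apply: cvg_trans df; apply: near_eq_cvg; near=> h.
  by rewrite /= [h *: 1]mulr1.
apply: cvgr_to_ge (cvg_dnbhs_at_right u_cvg) _; near=> h.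
rewrite mulr_ge0 ?subr_ge0//.
  by rewrite invr_ge0 ltW//; near: h; exact: nbhs_right_gt.
by near: h.
Unshelve. all: by end_near. Qed.

Lemma quantile_density_le
    d1 (T1 : measurableType d1) d2 (T2 : measurableType d2)
    (R : realType) (P1 : probability T1 R) (P2 : probability T2 R)
    (X : {RV P1 >-> R}) (Y : {RV P2 >-> R}) v :
  disp_le X Y -> v \in `]0, 1[ ->
  derivable (quantile X) v 1 -> derivable (quantile Y) v 1 ->
  quantile_density X v <= quantile_density Y v.
Proof.
move=> XY v01 dX dY; rewrite /quantile_density !derive1E -subr_ge0 -deriveB//.
rewrite -derive1E; apply: derive1_ge0_at_right; first exact: derivableB.
have [v0 v1] : 0 < v /\ v < 1 by move: v01; rewrite in_itv/= => /andP.
near=> h.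
have h0 : 0 < h by near: h; exact: nbhs_right_gt.
have hv : h < 1 - v by near: h; apply: nbhs_right_lt; rewrite subr_gt0.
apply: XY => //; last by rewrite lerDr ltW.
by rewrite in_itv/= addr_gt0//= -ltrBrDr.
Unshelve. all: by end_near. Qed.

Theorem theorem3p3 (R : realType)
  (d1 : measure_display) (T1 : measurableType d1) (P1 : probability T1 R)
  (d2 : measure_display) (T2 : measurableType d2) (P2 : probability T2 R)
  (X : {RV P1 >-> R}) (Y : {RV P2 >-> R}) (eta : R)
  (X_ge0 : nonneg_rv X) (Y_ge0 : nonneg_rv Y)
  (X_ac : abs_continuous_rv X) (Y_ac : abs_continuous_rv Y)
  (eta_gt0 : 0 < eta)
  (X_fin : dqfgcpe_finite eta X) (Y_fin : dqfgcpe_finite eta Y)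
  (XY : disp_le X Y) :
  dqfgcpe_le eta X Y.
Proof.
move=> v v01.
have [v0 v1] : 0 < v /\ v < 1 by move: v01; rewrite in_itv/= => /andP.
rewrite /dqfgcpe ler_wpM2l//.
  rewrite invr_ge0 mulr_ge0 ?(ltW v0)//.
  by apply: Rintegral_ge0 => t _; rewrite mulr_ge0 ?powR_ge0 ?expR_ge0.
apply: ae_le_Rintegral; [by []|exact: X_fin|exact: Y_fin|].
apply: filterS2 (ae_derivable_quantile _ _ _ _ _ X_ac)
    (ae_derivable_quantile _ _ _ _ _ Y_ac).
  exact: (ae_filter_ringOfSetsType (@lebesgue_measure R)).
move=> p dX dY.
rewrite /= in_itv/= => /andP[p0 pv].
have p01 : p \in `]0, 1[ by rewrite in_itv/= p0 (lt_trans pv).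
rewrite /dqfgcpe_integrand ler_wpM2l ?mulr_ge0 ?powR_ge0 ?(ltW p0)//.
by apply: quantile_density_le => //; [exact: dX|exact: dY].
Qed.
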